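(* If $G$ is a graph with no full edge and with minimum degree $\delta(G)\ge 1$, then $1+\delta(G)\le EC(G)$.
   Context: Graphs are finite and simple. Two distinct edges are adjacent if they share an endpoint. An edge of $G$ is a full edge if it is adjacent to every other edge of $G$. A set $D\subseteq E$ is an edge-dominating set of $G=(V,E)$ if every edge in $E\setminus D$ is adjacent to an edge of $D$. Two disjoint sets of edges $E_1,E_2$ form an edge coalition if neither is an edge-dominating set but $E_1\cup E_2$ is. An $ec$-partition of $G$ is a partition $\pi=\{E_1,\ldots,E_k\}$ of $E$ into nonempty sets such that every $E_i$ is either a singleton edge-dominating set, or is not an edge-dominating set but forms an edge coalition with another set $E_j$ of $\pi$. The edge coalition number $EC(G)$ is the maximum order $k$ of an $ec$-partition of $G$. *)

(* Defs.v *)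
From mathcomp Require Import all_boot.

Set Implicit Arguments.
Unset Strict Implicit.
Unset Printing Implicit Defensive.

(** A finite simple graph is a symmetric irreflexive relation [e] on a finType
    [T]; an edge is the two-element set of its endpoints. *)

Section EdgeCoalition.
Variables (T : finType) (e : rel T).
Implicit Types (f g : {set T}) (D A B : {set {set T}}) (P : {set {set {set T}}}).

Definition edges : {set {set T}} :=
  [set f | [exists x, exists y, e x y && (f == [set x; y])]].

Definition degree (v : T) : nat := #|[set w | e v w]|.

(** Every degree is less than [#|T|] by irreflexivity, so the default value
    [#|T|] only matters on the graph without vertices, where it is [0]. *)
Definition min_degree : nat := \big[minn/#|T|]_(v : T) degree v.

Definition edge_adjacent f g : bool := (f != g) && (f :&: g != set0).

Definition full_edge f : bool :=
  (f \in edges) && [forall g in edges, (g != f) ==> edge_adjacent f g].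

Definition edge_dominating D : bool :=
  (D \subset edges) &&
  [forall f in edges :\: D, exists g in D, edge_adjacent f g].

Definition edge_coalition A B : bool :=
  [&& A \subset edges, B \subset edges, [disjoint A & B],
      ~~ edge_dominating A, ~~ edge_dominating B & edge_dominating (A :|: B)].

(** [partition] already requires the classes to be nonempty. *)
Definition ec_partition P : bool :=
  partition P edges &&
  [forall A in P,
     (#|A| == 1) && edge_dominating A
     || ~~ edge_dominating A && [exists B in P, (B != A) && edge_coalition A B]].

(** The value is [0] if there is no ec-partition at all. *)
Definition edge_coalition_number : nat :=
  \max_(P : {set {set {set T}}} | ec_partition P) #|P|.

End EdgeCoalition.

(* Main.v *)
Require Import Defs.
From mathcomp Require Import all_boot.

Set Implicit Arguments.
Unset Strict Implicit.
Unset Printing Implicit Defensive.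

(** Let [A] be an inclusion-maximal set of edges that is not edge-dominating.
    By maximality [A] together with any single edge [g] outside [A] is
    edge-dominating, whereas [[set g]] alone is not, because there is no full
    edge.  So splitting the complement of [A] into singletons gives an
    ec-partition in which every singleton forms a coalition with [A]
    ([ec_partition_singletons]).  It has [1 + #|edges e :\: A|] classes, and
    the complement of [A] is large: some edge [f] is neither in [A] nor
    adjacent to an edge of [A], so all the edges at an endpoint of [f], at
    least [min_degree e] of them, lie outside [A]
    ([non_dominating_complement]). *)

Section EdgeCoalitionLowerBound.
Variables (T : finType) (e : rel T).
Implicit Types (f g : {set T}) (A D : {set {set T}}).

Lemma min_degree_le v : min_degree e <= degree e v.
Proof.
rewrite /min_degree; elim: (index_enum T) (mem_index_enum v) => // w s IHs.
rewrite inE big_cons geq_min => /orP[/eqP-> | /IHs->]; first by rewrite leqnn.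
by rewrite orbT.
Qed.

Lemma min_degree_le_card : min_degree e <= #|T|.
Proof.
rewrite /min_degree; elim/big_rec: _ => // v d _ le_d.
by rewrite geq_min le_d orbT.
Qed.

Lemma mem_edges x y : e x y -> [set x; y] \in edges e.
Proof.
by move=> exy; rewrite inE; apply/existsP; exists x; apply/existsP; exists y;
  rewrite exy eqxx.
Qed.

Lemma edge_adjacentC f g : edge_adjacent f g = edge_adjacent g f.
Proof. by rewrite /edge_adjacent eq_sym setIC. Qed.

Lemma exists_edge : 0 < min_degree e -> exists f, f \in edges e.
Proof.
move=> deg_gt0; have /card_gt0P[v _] := leq_trans deg_gt0 min_degree_le_card.
have /card_gt0P[w] := leq_trans deg_gt0 (min_degree_le v).
by rewrite inE => /mem_edges; exists [set v; w].
Qed.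

Lemma dominating_set1_full f : edge_dominating e [set f] -> full_edge e f.
Proof.
case/andP; rewrite sub1set => ef /forall_inP dom_f.
rewrite /full_edge ef; apply/forall_inP => g eg; apply/implyP => g_neq_f.
have /exists_inP[h /set1P->] : [exists h in [set f], edge_adjacent g h].
  by apply: dom_f; rewrite !inE g_neq_f; rewrite inE in eg.
by rewrite edge_adjacentC.
Qed.

Lemma degree_star (e_irr : irreflexive e) x :
  #|[set [set x; w] | w in [set w | e x w]]| = degree e x.
Proof.
apply: card_in_imset => w w' exw _ eq_edges.
have: w \in [set x; w'] by rewrite -eq_edges set22.
by case/set2P => // w_eq_x; rewrite w_eq_x inE e_irr in exw.
Qed.

(** An undominated edge witnesses that [A] avoids the whole star of each of
    its endpoints. *)
Lemma non_dominating_complement A :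
    irreflexive e -> A \subset edges e -> ~~ edge_dominating e A ->
  min_degree e <= #|edges e :\: A|.
Proof.
move=> e_irr sAE; rewrite /edge_dominating sAE negb_forall_in.
case/exists_inP => f /setDP[ef fNA]; rewrite negb_exists_in.
move/forall_inP => undom_f; move: ef; rewrite inE.
case/existsP => x /existsP[y /andP[exy /eqP f_def]].
apply: leq_trans (min_degree_le x) _; rewrite -(degree_star e_irr).
apply/subset_leq_card/subsetP => _ /imsetP[w exw ->]; rewrite inE in exw.
rewrite in_setD mem_edges // andbT; apply/negP => xwA.
have /negP[] := undom_f _ xwA; rewrite /edge_adjacent; apply/andP; split.
  by apply: contraNneq fNA => ->.
by apply/set0Pn; exists x; rewrite f_def in_setI !set21.
Qed.

Definition singleton_partition A : {set {set {set T}}} :=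
  A |: [set [set g] | g in edges e :\: A].

Lemma singleton_partitionP A :
    A \subset edges e -> A != set0 ->
  partition (singleton_partition A) (edges e)
  /\ #|singleton_partition A| = 1 + #|edges e :\: A|.
Proof.
move=> sAE A_neq0; set S := [set [set g] | g in edges e :\: A].
have S_neq0 : set0 \notin S.
  by apply/imsetP => -[g _ /setP/(_ g)]; rewrite !inE eqxx.
have disjAS : {in S, forall B : {set {set T}}, [disjoint A & B]}.
  move=> _ /imsetP[g /setDP[_ gNA] ->].
  by rewrite disjoint_sym disjoints1.
have trivS : trivIset S.
  apply/trivIsetP => _ _ /imsetP[g _ ->] /imsetP[h _ ->] g_neq_h.
  by rewrite disjoints1 inE; apply: contraNneq g_neq_h => ->.
have [trivP ANS] := trivIsetU1 disjAS trivS S_neq0.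
split; last by rewrite cardsU1 ANS card_imset //; apply: set1_inj.
rewrite /partition trivP !inE negb_or [set0 == A]eq_sym A_neq0 S_neq0 !andbT.
apply/eqP/setP => g; apply/bigcupP/idP => [[B /setU1P[->|]] | eg].
- exact: (subsetP sAE).
- by case/imsetP => h /setDP[eh _] -> /set1P->.
have [gA | gNA] := boolP (g \in A); first by exists A => //; apply: setU11.
exists [set g]; last exact: set11.
by apply/setU1r/imset_f; rewrite in_setD gNA.
Qed.

Lemma ec_partition_singletons A :
    A \subset edges e -> A != set0 -> ~~ edge_dominating e A ->
    edges e :\: A != set0 ->
    {in edges e, forall g, ~~ edge_dominating e [set g]} ->
    {in edges e :\: A, forall g, edge_dominating e (g |: A)} ->
  ec_partition e (singleton_partition A).
Proof.
move=> sAE A_neq0 ndomA /set0Pn[g0 g0P] ndom1 domU1.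
have coal g : g \in edges e :\: A -> edge_coalition e A [set g].
  move=> gP; have /setDP[eg gNA] := gP.
  by rewrite /edge_coalition sAE sub1set eg disjoint_sym disjoints1 gNA
             ndomA ndom1 // setUC domU1.
have A_neq1 g : g \in edges e :\: A -> [set g] != A.
  by case/setDP => _; apply: contraNneq => <-; rewrite set11.
have [partP _] := singleton_partitionP sAE A_neq0.
rewrite /ec_partition partP; apply/forall_inP => B /setU1P[-> | ].
  rewrite ndomA orbC /=; apply/orP; left; apply/exists_inP.
  exists [set g0]; first by apply/setU1r/imset_f.
  by rewrite A_neq1 // coal.
case/imsetP => g gP ->; have /setDP[eg gNA] := gP.
rewrite ndom1 // orbC; apply/orP; left; apply/exists_inP.
exists A; first exact: setU11.
rewrite eq_sym A_neq1 //=; case/and5P: (coal g gP) => sA s1 dj nA /andP[n1 dU].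
by rewrite /edge_coalition sA s1 disjoint_sym dj nA n1 setUC dU.
Qed.

End EdgeCoalitionLowerBound.

Theorem theorem5p3 (T : finType) (e : rel T)
    (e_sym : symmetric e) (e_irr : irreflexive e)
    (no_full : ~ exists f : {set T}, full_edge e f)
    (min_deg : 1 <= min_degree e) :
  1 + min_degree e <= edge_coalition_number e.
Proof.
have ndom1 g : ~~ edge_dominating e [set g].
  by apply/negP => /dominating_set1_full full_g; apply: no_full; exists g.
have [f ef] := exists_edge min_deg.
pose nondom (D : {set {set T}}) := (D \subset edges e) && ~~ edge_dominating e D.
(* Starting the maximal set from a singleton makes it nonempty. *)
have /maxset_exists[A] : nondom [set f] by rewrite /nondom sub1set ef ndom1.
case/maxsetP => /andP[sAE ndomA] maxA; rewrite sub1set => fA.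
have A_neq0 : A != set0 by apply/set0Pn; exists f.
have le_deg := non_dominating_complement e_irr sAE ndomA.
have domU1 : {in edges e :\: A, forall g, edge_dominating e (g |: A)}.
  move=> g /setDP[eg gNA]; apply: contraNT gNA => ndomU.
  rewrite -(maxA (g |: A)) ?setU11 ?subsetUr //.
  by rewrite /nondom subUset sub1set eg sAE.
have [_ card_P] := singleton_partitionP sAE A_neq0.
apply: (@leq_trans #|singleton_partition e A|); first by rewrite card_P leq_add2l.
apply: leq_bigmax_cond; apply: ec_partition_singletons => //.
by rewrite -card_gt0 (leq_trans min_deg).
Qed.
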